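(* Consider a sequence (indexed by $n\to\infty$) of attributed Erdős–Rényi pairs $\mathcal{G}(n,\bm p;m,\bm q)$ with $p_{00}=1$ (no user-user edges), where $m$ and $\bm q$ may depend on $n$. Let $\psi_{\mathrm a}=(\sqrt{q_{11}q_{00}}-\sqrt{q_{10}q_{01}})^2$. Achievability: If $m\psi_{\mathrm a}-\log n\to+\infty$, then the MAP estimator achieves exact alignment with high probability, i.e. $\lim_{n\to\infty}\mathsf P(\hat\pi_{\mathrm{MAP}}(G_1,G_2')\ne\Pi^* )=0$. Converse: If $\log n-mq_{11}\to+\infty$, then for any estimator the probability of error is bounded away from zero: for any sequence of estimators $\hat\pi$, $\liminf_{n\to\infty}\mathsf P(\hat\pi(G_1,G_2')\neq\Pi^* )>0$.
   Context: Attributed Erdős–Rényi pair $\mathcal{G}(n,\bm p;m,\bm q)$: two random graphs $G_1,G_2$ on a common vertex set consisting of $n$ user vertices $\mathcal V_{\mathrm u}=[n]$ and $m$ attribute vertices $\mathcal V_{\mathrm a}$ (disjoint from $\mathcal V_{\mathrm u}$). Let $\mathcal E_{\mathrm u}$ be the set of (unordered) pairs of distinct users and $\mathcal E_{\mathrm a}=\mathcal V_{\mathrm u}\times\mathcal V_{\mathrm a}$; there are no edges between attribute vertices. $G_k(e)\in\{0,1\}$ indicates whether $e$ is an edge of $G_k$. Independently over $e\in\mathcal E_{\mathrm u}\cup\mathcal E_{\mathrm a}$, $\mathsf P((G_1(e),G_2(e))=(a,b))=p_{ab}$ for $e\in\mathcal E_{\mathrm u}$ and $=q_{ab}$ for $e\in\mathcal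 E_{\mathrm a}$ ($a,b\in\{0,1\}$), where $\bm p=(p_{11},p_{10},p_{01},p_{00})$ and $\bm q=(q_{11},q_{10},q_{01},q_{00})$ are probability vectors. Here $p_{00}=1$, so the only random edges are user-attribute edges (bipartite graph pair). Standing assumption: for every user-attribute pair $e$, $G_1(e)$ and $G_2(e)$ are positively correlated (correlation coefficient defined and $>0$). Anonymization: $\Pi^*$ is uniform on the set $\mathcal S_n$ of permutations of $[n]$, independent of $(G_1,G_2)$, and $G_2'$ is obtained from $G_2$ by relabeling each user $i$ as $\Pi^*(i)$ (attribute vertices keep their labels). An estimator is a function $\hat\pi(G_1,G_2')\in\mathcal S_n$. The MAP estimator $\hat\pi_{\mathrm{MAP}}(G_1,G_2')$ is a maximizer over $\pi\in\mathcal S_n$ of the posterior $\mathsf P(\Pi^*=\pi\mid G_1,G_2')$. *)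

(* Defs.v *)
From HB Require Import structures.
From mathcomp Require Import all_boot all_order all_algebra all_fingroup.
From mathcomp Require Import all_classical all_reals all_analysis.
Set Implicit Arguments.
Unset Strict Implicit.
Unset Printing Implicit Defensive.
Import Order.TTheory GRing.Theory Num.Theory.
Import numFieldNormedType.Exports.
Local Open Scope classical_set_scope.
Local Open Scope ring_scope.

(* A probability on a finite sample space is given by its mass function.      *)
Section FiniteProbability.
Variables (R : realType) (Omega : finType) (mu : Omega -> R).

Definition Pr (A : pred Omega) : R := \sum_(w | A w) mu w.

(* The value is 0 when the conditioning event B is null. *)
Definition condPr (A B : pred Omega) : R := Pr (predI A B) / Pr B.

Definition Ex (X : Omega -> R) : R := \sum_w mu w * X w.

Definition cov (X Y : Omega -> R) : R :=
  Ex (fun w => (X w - Ex X) * (Y w - Ex Y)).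

Definition var (X : Omega -> R) : R := cov X X.

Definition corr (X Y : Omega -> R) : R :=
  cov X Y / (Num.sqrt (var X) * Num.sqrt (var Y)).

(* The first two conditions say that the correlation coefficient is defined.  *)
Definition positively_correlated (X Y : Omega -> R) : Prop :=
  [/\ 0 < var X, 0 < var Y & 0 < corr X Y].

End FiniteProbability.

Section Graphs.
Variables n m : nat.

Definition user_pair := {e : {set 'I_n} | #|e| == 2%N}.

(* The vertex pairs that may carry an edge: E_u (inl) and E_a (inr). *)
Definition vpair := (user_pair + 'I_n * 'I_m)%type.

(* g e = true iff e is an edge of g. *)
Definition graph := {ffun vpair -> bool}.

Lemma move_user_pair_subproof (s : 'S_n) (e : user_pair) :
  #|s @: val e| == 2%N.
Proof. by rewrite card_imset ?(valP e)//; exact: perm_inj. Qed.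

Definition move_user_pair (s : 'S_n) (e : user_pair) : user_pair :=
  exist _ (s @: val e) (move_user_pair_subproof s e).

Definition move_vpair (s : 'S_n) (e : vpair) : vpair :=
  match e with
  | inl u => inl (move_user_pair s u)
  | inr (i, a) => inr (s i, a)
  end.

(* The graph obtained from g by renaming each user i as s i; see relabelE.    *)
Definition relabel (s : 'S_n) (g : graph) : graph :=
  [ffun e => g (move_vpair s^-1%g e)].

Lemma relabelE (s : 'S_n) (g : graph) (e : vpair) :
  relabel s g (move_vpair s e) = g e.
Proof.
rewrite ffunE; congr (g _); case: e => [u|[i a]] /=; last by rewrite permK.
congr inl; apply: val_inj => /=; rewrite -imset_comp.
by rewrite (eq_imset (g := id)) ?imset_id// => i /=; rewrite permK.
Qed.

End Graphs.

(* The law of an edge pair: p a b stands for p_{ab}, with true for 1 and      *)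
(* false for 0.                                                               *)
Definition edge_law (R : realType) := bool -> bool -> R.

Definition prob_vector (R : realType) (p : edge_law R) : Prop :=
  (forall a b, 0 <= p a b) /\ \sum_(a : bool) \sum_(b : bool) p a b = 1.

Definition psi (R : realType) (q : edge_law R) : R :=
  (Num.sqrt (q true true * q false false)
   - Num.sqrt (q true false * q false true)) ^+ 2.

Section Model.
Variables (R : realType) (n m : nat) (p q : edge_law R).

Definition vpair_law (e : vpair n m) : edge_law R :=
  match e with inl _ => p | inr _ => q end.

Definition ER_pair_mass (g1 g2 : graph n m) : R :=
  \prod_(e : vpair n m) vpair_law e (g1 e) (g2 e).

(* An outcome consists of G_1, G_2 and the anonymizing permutation Pi^*.      *)
Definition outcome := (graph n m * graph n m * 'S_n)%type.
Definition G1 (w : outcome) : graph n m := w.1.1.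
Definition G2 (w : outcome) : graph n m := w.1.2.
Definition PiStar (w : outcome) : 'S_n := w.2.
Definition G2' (w : outcome) : graph n m := relabel (PiStar w) (G2 w).

(* A product mass: Pi^* is uniform on S_n and independent of (G_1, G_2). *)
Definition mass (w : outcome) : R := ER_pair_mass (G1 w) (G2 w) / n`!%:R.

Definition edge_indicator (G : outcome -> graph n m) (e : vpair n m)
  (w : outcome) : R := (G w e)%:R.

Definition attribute_edges_positively_correlated : Prop :=
  forall (i : 'I_n) (a : 'I_m),
    positively_correlated mass (edge_indicator G1 (inr (i, a)))
                               (edge_indicator G2 (inr (i, a))).

Definition estimator := graph n m -> graph n m -> 'S_n.

Definition error_prob (pihat : estimator) : R :=
  Pr mass (fun w => pihat (G1 w) (G2' w) != PiStar w).

Definition posterior (g1 g2 : graph n m) (s : 'S_n) : R :=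
  condPr mass (fun w => PiStar w == s)
              (fun w => (G1 w == g1) && (G2' w == g2)).

(* pihat picks a maximizer of the posterior, with ties broken arbitrarily. *)
Definition is_MAP (pihat : estimator) : Prop :=
  forall (g1 g2 : graph n m) (s : 'S_n),
    posterior g1 g2 s <= posterior g1 g2 (pihat g1 g2).

End Model.

(* Main.v *)
(* Achievability. If the MAP estimator errs, some permutation s <> 1 has a
   likelihood at least that of the truth, so the error probability is at most
   the sum over s <> 1 of the Bhattacharyya coefficients. Summing out G_1, the
   coefficient of s becomes the sum over y of prod_e M (y e) (y (s e)), where M
   is the 2 x 2 overlap matrix, of trace 1 and squared Frobenius norm
   1 - 2 psi. Integrating out one coordinate at a time with the Cauchy-Schwarz
   inequality bounds a fixed point by the trace and any other factor by the
   Frobenius norm, with no reference to the cycle structure of s. This gives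
   (1 - 2 psi)^(m k / 2) <= exp(- m psi k) when s moves k users, and at most
   n^k permutations do so.

   Converse. Call two users twins if they have the same attributes in the graph
   of edges common to G_1 and G_2. By positive correlation, exchanging twins
   does not decrease the likelihood, so the error probability is at least half
   the probability that twins exist. A given pair is twin with probability
   (q11^2 + (1 - q11)^2)^m >= exp(- 2 m q11), which is much larger than n^-2,
   and the second moment method applies: the event that {i, j} and {k, l} are
   both twins says that a suitable permutation fixes all neighbourhoods, and the
   probability of this is bounded by the same inequality as above. *)

Require Import Defs.
From HB Require Import structures.
From mathcomp Require Import all_boot all_order all_algebra all_fingroup.
From mathcomp Require Import all_classical all_reals all_analysis.
From mathcomp Require Import ring lra.
Set Implicit Arguments.
Unset Strict Implicit.
Unset Printing Implicit Defensive.
Import Order.TTheory GRing.Theory Num.Theory.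
Import numFieldNormedType.Exports.
Local Open Scope ring_scope.

(** * Cauchy-Schwarz inequalities, for one sum and along the cycles of an injection *)

Lemma sum_mul_le (R : rcfType) (T : finType) (a b : T -> R) :
  (\sum_t a t * b t) ^+ 2 <= (\sum_t a t ^+ 2) * (\sum_t b t ^+ 2).
Proof.
have E x y : (\sum_t x t) * (\sum_t y t) = \sum_s \sum_t x s * y t :> R.
  by rewrite mulr_suml; apply: eq_bigr => s _; rewrite mulr_sumr.
(* Lagrange's identity: this double sum is twice the difference of the two sides. *)
have : 0 <= \sum_s \sum_t (a s * b t - a t * b s) ^+ 2.
  by apply: sumr_ge0 => s _; apply: sumr_ge0 => t _; exact: sqr_ge0.
have -> : \sum_s \sum_t (a s * b t - a t * b s) ^+ 2 =
    \sum_s \sum_t a s ^+ 2 * b t ^+ 2 + \sum_s \sum_t a t ^+ 2 * b s ^+ 2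
    - 2 * \sum_s \sum_t (a s * b s) * (a t * b t).
  rewrite mulr_sumr -big_split -sumrB/=; apply: eq_bigr => s _.
  rewrite mulr_sumr -big_split -sumrB/=; apply: eq_bigr => t _; ring.
rewrite [X in _ + X - _]exchange_big /= -!E => h.
by rewrite expr2; lra.
Qed.

Lemma sum_mul_le_sqrt (R : rcfType) (T : finType) (a b : T -> R) :
  \sum_t a t * b t <=
  Num.sqrt (\sum_t a t ^+ 2) * Num.sqrt (\sum_t b t ^+ 2).
Proof.
have a0 : 0 <= \sum_t a t ^+ 2 by apply: sumr_ge0 => t _; exact: sqr_ge0.
rewrite -sqrtrM//; apply: le_trans (ler_norm _) _.
by rewrite -sqrtr_sqr ler_wsqrtr// sum_mul_le.
Qed.

Section HolderCycles.
Variables (R : rcfType) (I T : finType) (f : I -> I).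
Hypothesis injf : injective f.
Variable M : I -> T -> T -> R.
Hypothesis M_ge0 : forall i s t, 0 <= M i s t.

Let upd (y : {ffun I -> T}) j v : {ffun I -> T} :=
  [ffun i => if i == j then v else y i].

(** Exchanging [y j] with the spare value [v] is an involution that turns [upd y j v] into [y]. A
    coordinate can thus be summed out without changing the index type, at the price of a factor
    [#|T|]. *)
Lemma sum_upd (G : {ffun I -> T} -> R) j :
  \sum_y \sum_v G (upd y j v) = #|T|%:R * \sum_y G y.
Proof.
pose h (p : {ffun I -> T} * T) := (upd p.1 j p.2, p.1 j).
have hK : involutive h.
  move=> [y v]; rewrite /h /=; congr pair; last by rewrite ffunE eqxx.
  by apply/ffunP => i; rewrite !ffunE; case: eqP => // ->.
rewrite pair_bigA/= (reindex_inj (can_inj hK))/=.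
rewrite (eq_bigr (fun p => G p.1)); last first.
  move=> [y v] _ /=; congr G; apply/ffunP => i.
  by rewrite !ffunE; case: eqP => // ->.
rewrite -(pair_bigA _ (fun y _ => G y))/= mulr_sumr; apply: eq_bigr => y _.
by rewrite sumr_const mulr_natl.
Qed.

(* [K A i y] is the factor of index [i] once the coordinates in [A] have been
   summed out. *)
Let K (A : seq I) i (y : {ffun I -> T}) : R :=
  if f i == i then \sum_(s | (i \in A) || (s == y i)) M i s s
  else Num.sqrt (\sum_(s | (i \in A) || (s == y i))
                 \sum_(t | (f i \in A) || (t == y (f i))) M i s t ^+ 2).

Let K_ge0 A i y : 0 <= K A i y.
Proof. by rewrite /K; case: ifP => _; rewrite ?sqrtr_ge0// sumr_ge0. Qed.

Let K_upd A i j y v : i != j -> f i != j -> K A i (upd y j v) = K (j :: A) i y.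
Proof.
by move=> ij fij; rewrite /K !ffunE !inE (negbTE ij) (negbTE fij).
Qed.

(** By injectivity, coordinate [j] enters only the factor at [j] and the factor at its preimage [k].
    If [f] fixes [j], this is a single factor and its sum is a trace; otherwise Cauchy-Schwarz in
    [v] separates the two. *)
Let K_step A j y : j \notin A ->
  \sum_v \prod_i K A i (upd y j v) <= \prod_i K (j :: A) i y.
Proof.
move=> jA; case: (boolP (f j == j)) => fj.
  rewrite (bigD1 j)//= (eq_bigr
    (fun v => M j v v * \prod_(i | i != j) K (j :: A) i y)); last first.
    move=> v _; rewrite (bigD1 j)//=; congr (_ * _).
      by rewrite /K fj (negbTE jA)/= big_pred1_eq ffunE eqxx.
    apply: eq_bigr => i ij; rewrite K_upd//.
    by apply: contraNneq ij => e; apply/eqP/injf; rewrite e (eqP fj).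
  rewrite -mulr_suml le_eqVlt; apply/orP; left; apply/eqP; congr (_ * _).
  by rewrite /K fj inE eqxx.
have [k fk] : exists k, f k = j.
  by have [g fK gK] := injF_bij injf; exists (g j).
have kj : k != j by apply: contraNneq fj => e; rewrite -{1}e fk.
have fkk : f k != k by rewrite fk eq_sym.
rewrite (bigD1 j)//= (bigD1 k)//= (eq_bigr (fun v =>
    K A j (upd y j v) * K A k (upd y j v) *
    \prod_(i | (i != j) && (i != k)) K (j :: A) i y)); last first.
  move=> v _; rewrite (bigD1 j)//= (bigD1 k)//= mulrA; congr (_ * _).
  apply: eq_bigr => i /andP[ij ik]; rewrite K_upd//.
  by apply: contraNneq ik => e; apply/eqP/injf; rewrite e fk.
rewrite -mulr_suml mulrA ler_wpM2r//; first exact: prodr_ge0.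
apply: le_trans (sum_mul_le_sqrt _ _) _.
have Ksqr i z : f i != i -> K A i z ^+ 2 =
    \sum_(s | (i \in A) || (s == z i))
       \sum_(t | (f i \in A) || (t == z (f i))) M i s t ^+ 2.
  move=> fi; rewrite /K (negbTE fi) sqr_sqrtr//.
  by apply: sumr_ge0 => s _; apply: sumr_ge0 => t _; exact: sqr_ge0.
rewrite le_eqVlt; apply/orP; left; apply/eqP; congr (_ * _).
  rewrite [in RHS]/K (negbTE fj); congr Num.sqrt.
  rewrite inE eqxx/=; apply: eq_bigr => v _.
  rewrite Ksqr// (negbTE jA)/= !ffunE eqxx big_pred1_eq.
  by apply: eq_bigl => t; rewrite inE (negbTE fj).
rewrite [in RHS]/K (negbTE fkk) [in RHS]inE (negbTE kj)/=; congr Num.sqrt.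
rewrite fk inE eqxx/=.
rewrite (eq_bigr (fun v => \sum_(s | (k \in A) || (s == y k)) M k s v ^+ 2)).
  exact: exchange_big.
move=> v _; rewrite Ksqr// !ffunE (negbTE kj) fk eqxx (negbTE jA)/=.
by apply: eq_bigr => s _; rewrite big_pred1_eq.
Qed.

(** Once every coordinate has been summed out, [K] no longer depends on [y], and the powers of
    [#|T|] on both sides cancel. *)
Lemma sum_prod_cycle_le :
  \sum_(y : {ffun I -> T}) \prod_i M i (y i) (y (f i)) <=
  \prod_i (if f i == i then \sum_t M i t t
           else Num.sqrt (\sum_s \sum_t M i s t ^+ 2)).
Proof.
have sums A : uniq A ->
    #|T|%:R ^+ size A * (\sum_y \prod_i K [::] i y) <= \sum_y \prod_i K A i y.
  elim: A => [|j A IH]; first by rewrite mul1r.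
  move=> /= /andP[jA uA]; rewrite exprS -mulrA.
  apply: le_trans (ler_wpM2l _ (IH uA)) _ => //.
  by rewrite -(sum_upd _ j); apply: ler_sum => y _; exact: K_step.
have := sums (enum I) (enum_uniq _).
rewrite -cardE (eq_bigr (fun y : {ffun I -> T} =>
  \prod_i M i (y i) (y (f i)))); last first.
  move=> y _; apply: eq_bigr => i _; rewrite /K.
  case: ifP => [/eqP ->|_]; first by rewrite big_pred1_eq.
  by rewrite !big_pred1_eq sqrtr_sqr ger0_norm.
rewrite [leRHS](eq_bigr (fun=> \prod_i (if f i == i then \sum_t M i t t
           else Num.sqrt (\sum_s \sum_t M i s t ^+ 2)))); last first.
  move=> y _; apply: eq_bigr => i _; rewrite /K mem_enum/=.
  by case: ifP => // _; congr Num.sqrt; apply: eq_bigr => s _; rewrite mem_enum.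
rewrite sumr_const card_ffun -[leRHS]mulr_natl natrX.
(* For empty [T] nothing can be cancelled: either [I] is inhabited and there is no [y], or [I] is
   empty and both sides are 1. *)
case: (posnP #|T|) => [T0|Tpos]; last first.
  by rewrite ler_pM2l// exprn_gt0// ltr0n.
move=> _; case: (pickP (@predT I)) => [i _|I0].
  rewrite big1 => [|y _]; first by apply: prodr_ge0 => j _;
    case: ifP => _; rewrite ?sqrtr_ge0// sumr_ge0.
  by have := card0_eq T0 (y i); rewrite inE.
rewrite [leRHS]big1 => [|i _]; last by have := I0 i.
rewrite (eq_bigr (fun=> 1)) => [|y _]; last by rewrite big1// => i; have := I0 i.
by rewrite sumr_const card_ffun (eq_card0 I0) expn0.
Qed.

End HolderCycles.

(** * Permutations counted by the size of their support *)

Definition support n (s : 'S_n) : {set 'I_n} := [set i | s i != i].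

(** At most [k!] permutations have a given support of size [k], and ['C(n, k) * k! <= n ^ k], so the
    size [k] contributes at most [z ^ k]. This leaves a geometric sum of ratio at most 1/2, starting
    at [k = 1]. *)
Lemma sum_expr_support_le (R : realFieldType) n (x : R) :
  0 <= x -> n%:R * x <= 2^-1 ->
  \sum_(s : 'S_n | s != 1%g) x ^+ #|support s| <= 2 * (n%:R * x).
Proof.
move=> x0; set z := n%:R * x => z2.
have z0 : 0 <= z by rewrite mulr_ge0.
rewrite (partition_big (@support n) (fun S => S != finset.set0))/=; last first.
  move=> s s1; apply: contraNneq s1 => s0; apply/eqP/permP => i.
  have : i \notin support s by rewrite s0 inE.
  by rewrite inE negbK perm1 => /eqP.
apply: (@le_trans _ _
    (\sum_(S : {set 'I_n} | S != finset.set0) (#|S|)`!%:R * x ^+ #|S|)).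
  apply: ler_sum => S _; rewrite -card_perm mulr_natl -sumr_const.
  rewrite [leRHS](bigID (fun s => (s != 1%g) && (support s == S)))/=.
  apply: le_trans (_ : \sum_(s | (s \in perm_on S) && ((s != 1%g) &&
      (support s == S))) x ^+ #|S| <= _); last first.
    by rewrite lerDl sumr_ge0// => s _; exact: exprn_ge0.
  rewrite le_eqVlt; apply/orP; left; apply/eqP; apply: eq_big => s.
    case: (boolP (s != 1%g)) => //= _; last by rewrite andbF.
    apply/idP/andP => [/eqP <-|[]//]; split=> //.
    by apply/fintype.subsetP => i; rewrite !inE.
  by move=> /andP[_ /eqP ->].
rewrite (partition_big (fun S : {set 'I_n} => inord #|S| : 'I_n.+1)
  (fun k => k != ord0))/=; last first.
  move=> S; apply: contraNneq => /(congr1 val)/=.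
  rewrite inordK; last by rewrite ltnS -[X in (_ <= X)%N]card_ord max_card.
  by move=> /cards0_eq ->.
apply: (@le_trans _ _ (\sum_(k < n.+1 | k != ord0) z ^+ k)).
  apply: ler_sum => k k0.
  rewrite (eq_bigl (mem [set S : {set 'I_n} | #|S| == k])); last first.
    move=> S; rewrite !inE.
    have cS : (#|S| < n.+1)%N.
      by rewrite ltnS -[X in (_ <= X)%N]card_ord max_card.
    have -> : (inord #|S| == k) = (#|S| == k).
      by rewrite -val_eqE/= inordK.
    case: (altP (#|S| =P k)) => [Sk|]; last by rewrite andbF.
    rewrite andbT -card_gt0 Sk lt0n.
    by move: k0; rewrite -val_eqE.
  rewrite (eq_bigr (fun=> k`!%:R * x ^+ k)); last first.
    by move=> S; rewrite !inE => /eqP ->.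
  rewrite sumr_const card_draws card_ord -[leLHS]mulr_natl mulrA -natrM.
  rewrite bin_ffact.
  rewrite exprMn ler_wpM2r ?exprn_ge0// -natrX ler_nat.
  rewrite ffact_prod -[X in (_ <= _ ^ X)%N]card_ord -prod_nat_const.
  by apply: leq_prod => i _; exact: leq_subr.
rewrite big_mkcond big_ord_recl/= add0r.
rewrite (eq_bigr (fun i : 'I_n => z * z ^+ i)); last first.
  by move=> i _ /=; rewrite -exprS.
rewrite -mulr_sumr mulrC; apply: ler_wpM2r => //.
(* [z ^ n - 1] is [z - 1] times the geometric sum, which is therefore at most [1 / (1 - z) <= 2]. *)
have := subrX1 z n; have := exprn_ge0 n z0.
have : 0 <= \sum_(i < n) z ^+ i by apply: sumr_ge0 => i _; exact: exprn_ge0.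
by nra.
Qed.

(** * The action of user permutations on vertex pairs *)

Section Relabel.
Variables n m : nat.

Lemma move_vpairM (s t : 'S_n) (e : vpair n m) :
  move_vpair (s * t)%g e = move_vpair t (move_vpair s e).
Proof.
case: e => [u|[i a]]/=; last by rewrite permM.
congr inl; apply: val_inj => /=; rewrite -imset_comp; apply: eq_imset => i /=.
by rewrite permM.
Qed.

Lemma move_vpair1 (e : vpair n m) : move_vpair 1%g e = e.
Proof.
case: e => [u|[i a]]/=; last by rewrite perm1.
congr inl; apply: val_inj => /=; rewrite (eq_imset (g := id)) ?imset_id//.
by move=> i /=; rewrite perm1.
Qed.

Lemma move_vpair_inj (s : 'S_n) : injective (@move_vpair n m s).
Proof.
apply: can_inj (@move_vpair n m s^-1%g) _ => e.
by rewrite -move_vpairM mulgV move_vpair1.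
Qed.

Lemma relabelM (s t : 'S_n) (g : graph n m) :
  relabel t (relabel s g) = relabel (s * t)%g g.
Proof. by apply/ffunP => e; rewrite !ffunE -move_vpairM invMg. Qed.

Lemma relabel1 (g : graph n m) : relabel 1%g g = g.
Proof. by apply/ffunP => e; rewrite ffunE invg1 move_vpair1. Qed.

Lemma prod_vpair (R : comPzSemiRingType) (F : vpair n m -> R) :
  \prod_e F e = (\prod_u F (inl u)) * \prod_a \prod_i F (inr (i, a)).
Proof.
by rewrite big_sumType/= exchange_big pair_bigA/=; congr (_ * _);
  apply: eq_bigr => -[].
Qed.

(** The cycle inequality for [move_vpair s]. User pairs contribute factors at most 1; each user in
    the support moves [m] attribute pairs, and each of these costs one Frobenius norm. [T] will be
    [bool] for achievability and [bool * bool] for the converse. *)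
Lemma sum_prod_move_le (R : rcfType) (T : finType) (Mu Ma : T -> T -> R)
    (s : 'S_n) :
  (forall x y, 0 <= Mu x y) -> (forall x y, 0 <= Ma x y) ->
  \sum_x Mu x x = 1 -> \sum_x Ma x x = 1 ->
  \sum_x \sum_y Mu x y ^+ 2 <= 1 ->
  \sum_(y : {ffun vpair n m -> T})
     \prod_e (if e is inl _ then Mu else Ma) (y e) (y (move_vpair s e)) <=
  (Num.sqrt (\sum_x \sum_y Ma x y ^+ 2) ^+ m) ^+ #|support s|.
Proof.
move=> Mu0 Ma0 Mu1 Ma1 Mu2.
pose M (e : vpair n m) := if e is inl _ then Mu else Ma.
apply: le_trans (sum_prod_cycle_le (@move_vpair_inj s) (M := M) _) _.
  by case.
rewrite prod_vpair; set d := Num.sqrt _.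
have -> : (d ^+ m) ^+ #|support s| =
    \prod_(a < m) \prod_i (if s i == i then 1 else d).
  rewrite prodr_const card_ord exprAC -prodr_const; congr (_ ^+ _).
  rewrite big_mkcond; apply: eq_bigr => i _.
  by rewrite inE; case: eqP.
rewrite -[leRHS]mul1r; apply: ler_pM.
- apply: prodr_ge0 => e _; case: ifP => _; rewrite ?sqrtr_ge0//.
  exact: sumr_ge0.
- apply: prodr_ge0 => a _; apply: prodr_ge0 => e _.
  by case: ifP => _; rewrite ?sqrtr_ge0//; exact: sumr_ge0.
- apply: prodr_ile1 => e _; case: ifP => _; rewrite /= ?Mu1 ?ler01 ?lexx//.
  by rewrite sqrtr_ge0/= -[X in _ <= X]sqrtr1 ler_wsqrtr.
- rewrite le_eqVlt; apply/orP; left; apply/eqP; apply: eq_bigr => a _.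
  apply: eq_bigr => i _ /=; rewrite Ma1.
  have -> // : (inr (s i, a) == inr (i, a) :> vpair n m) = (s i == i).
  by apply/eqP/eqP => [[]|->].
Qed.

End Relabel.

(** * The overlap matrix of an edge law *)

Section EdgeLaw.
Variables (R : realType) (q : edge_law R).
Hypothesis q_prob : prob_vector q.

Let q_ge0 a b : 0 <= q a b. Proof. exact: q_prob.1. Qed.

Lemma edge_law_sum1 :
  q true true + q true false + (q false true + q false false) = 1.
Proof. by have [_] := q_prob; rewrite !big_bool/=. Qed.

(** The Bhattacharyya coefficient of the columns [u] and [v] of [q]. *)
Definition overlap (u v : bool) : R := \sum_x Num.sqrt (q x u * q x v).

Lemma overlap_ge0 u v : 0 <= overlap u v.
Proof. by apply: sumr_ge0 => x _; exact: sqrtr_ge0. Qed.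

Lemma overlap_trace : \sum_u overlap u u = 1.
Proof.
rewrite -edge_law_sum1 /overlap !big_bool/= -!expr2 !sqrtr_sqr !ger0_norm//.
ring.
Qed.

(* The overlap matrix is [S^T S] with [S = (sqrt (q x u))]: it has trace 1 and
   determinant [psi q], so that its squared eigenvalues add up to
   [1 - 2 psi q]. *)
Lemma overlap_frobenius : \sum_u \sum_v overlap u v ^+ 2 = 1 - 2 * psi q.
Proof.
have := edge_law_sum1; rewrite /psi /overlap !big_bool/= !sqrtrM//.
move: (sqr_sqrtr (q_ge0 true true)) (sqr_sqrtr (q_ge0 true false)).
move: (sqr_sqrtr (q_ge0 false true)) (sqr_sqrtr (q_ge0 false false)).
set d := Num.sqrt (q false false); set c := Num.sqrt (q false true).
set b := Num.sqrt (q true false); set a := Num.sqrt (q true true).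
move=> <- <- <- <- E.
transitivity ((a ^+ 2 + b ^+ 2 + (c ^+ 2 + d ^+ 2)) ^+ 2
  - 2 * (a * d - b * c) ^+ 2); first ring.
by rewrite E expr1n.
Qed.

Lemma psi_ge0 : 0 <= psi q. Proof. exact: sqr_ge0. Qed.

Lemma overlap_frobenius_le1 : \sum_u \sum_v overlap u v ^+ 2 <= 1.
Proof. by rewrite overlap_frobenius; have := psi_ge0; lra. Qed.

End EdgeLaw.

Lemma sqrtr_prod (R : rcfType) (I : finType) (F : I -> R) :
  (forall i, 0 <= F i) -> Num.sqrt (\prod_i F i) = \prod_i Num.sqrt (F i).
Proof.
move=> F0; rewrite -[RHS]ger0_norm; last first.
  by apply: prodr_ge0 => i _; exact: sqrtr_ge0.
rewrite -sqrtr_sqr -prodrXl; congr Num.sqrt; apply: eq_bigr => i _.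
by rewrite sqr_sqrtr.
Qed.

(** * Achievability: a union bound over the competing permutations *)

Section Achievability.
Variables (R : realType) (n m : nat) (p q : edge_law R).
Hypotheses (p_prob : prob_vector p) (q_prob : prob_vector q).

Local Notation L := (@ER_pair_mass R n m p q).

Lemma vpair_law_ge0 e a b : 0 <= @vpair_law R n m p q e a b.
Proof. by case: e => [u|x]; [exact: p_prob.1|exact: q_prob.1]. Qed.

Lemma ER_pair_mass_ge0 g1 g2 : 0 <= L g1 g2.
Proof. by apply: prodr_ge0 => e _; exact: vpair_law_ge0. Qed.

Lemma mass_ge0 (w : outcome n m) : 0 <= mass p q w.
Proof. by rewrite divr_ge0// ER_pair_mass_ge0. Qed.

Lemma sum_mass (F : graph n m -> graph n m -> R) :
  \sum_(w : outcome n m) mass p q w * F (G1 w) (G2 w) =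
  \sum_g1 \sum_g2 L g1 g2 * F g1 g2.
Proof.
rewrite pair_bigA/= [RHS](eq_bigr (fun g => \sum_(s : 'S_n)
    mass p q (g, s) * F g.1 g.2)).
  by rewrite pair_bigA; apply: eq_bigr => -[].
move=> g _; rewrite (eq_bigr (fun=> L g.1 g.2 / n`!%:R * F g.1 g.2))//.
rewrite sumr_const card_Sn mulrAC -[RHS]mulr_natr divfK//.
Qed.

Lemma sum_bhattacharyya_le (s : 'S_n) :
  \sum_g1 \sum_g2 Num.sqrt (L g1 g2 * L g1 (relabel s^-1%g g2)) <=
  (Num.sqrt (1 - 2 * psi q) ^+ m) ^+ #|support s|.
Proof.
rewrite -(overlap_frobenius q_prob); pose V := @vpair_law R n m p q.
apply: le_trans _ (@sum_prod_move_le n m R bool (overlap p) (overlap q) s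
  (@overlap_ge0 R p) (@overlap_ge0 R q) (overlap_trace p_prob)
  (overlap_trace q_prob) (overlap_frobenius_le1 p_prob)).
rewrite exchange_big/= le_eqVlt; apply/orP; left; apply/eqP.
apply: eq_bigr => g2 _.
(* For fixed [g2] the sum over [g1] factors over the vertex pairs, each giving one entry of an
   overlap matrix. *)
transitivity (\prod_e \sum_x
    Num.sqrt (V e x (g2 e) * V e x (g2 (move_vpair s e)))).
  rewrite bigA_distr_bigA/=; apply: eq_bigr => g1 _.
  rewrite /ER_pair_mass -big_split/= sqrtr_prod => [|e].
    by apply: eq_bigr => e _; rewrite ffunE invgK.
  by rewrite mulr_ge0 ?vpair_law_ge0.
by apply: eq_bigr => -[u|x].
Qed.

(** The event is a single outcome, since undoing [s] recovers [G2] from [G2']. *)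
Lemma Pr_observation (g1 g2 : graph n m) (s : 'S_n) :
  Pr (mass p q) (predI (fun w => PiStar w == s)
                       (fun w => (G1 w == g1) && (G2' w == g2))) =
  L g1 (relabel s^-1%g g2) / n`!%:R.
Proof.
rewrite /Pr (big_pred1 (g1, relabel s^-1%g g2, s))//.
move=> [[h1 h2] t] /=; rewrite /PiStar /G1 /G2' /G2 /=.
apply/and3P/eqP => [[/eqP -> /eqP -> /eqP <-]|[-> -> ->]].
  by rewrite relabelM mulgV relabel1.
by rewrite relabelM mulVg relabel1.
Qed.

Lemma MAP_error_le (pihat : estimator n m) : is_MAP p q pihat ->
  error_prob p q pihat <=
  \sum_(s : 'S_n | s != 1%g) (Num.sqrt (1 - 2 * psi q) ^+ m) ^+ #|support s|.
Proof.
move=> MAP.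
pose B g1 g2 s := Num.sqrt (L g1 g2 * L g1 (relabel s^-1%g g2)).
have B0 g1 g2 s : 0 <= B g1 g2 s by exact: sqrtr_ge0.
apply: (@le_trans _ _ (\sum_(w : outcome n m)
    \sum_(s : 'S_n | s != 1%g) B (G1 w) (G2 w) s / n`!%:R)).
  rewrite /error_prob /Pr big_mkcond; apply: ler_sum => w _.
  have sB0 : 0 <= \sum_(s : 'S_n | s != 1%g) B (G1 w) (G2 w) s / n`!%:R.
    by apply: sumr_ge0 => s _; rewrite divr_ge0.
  case: ifP => // err.
  (* The discrepancy between estimate and truth: undoing the estimate instead of [PiStar] on [G2']
     yields [relabel s^-1 G2]. *)
  pose s := (pihat (G1 w) (G2' w) * (PiStar w)^-1)%g.
  have s1 : s != 1%g.
    by rewrite -eq_mulgV1.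
  have relabels : relabel s^-1%g (G2 w) =
                  relabel (pihat (G1 w) (G2' w))^-1%g (G2' w).
    by rewrite /G2' relabelM /s invMg invgK.
  have Lle : L (G1 w) (G2 w) <= L (G1 w) (relabel s^-1%g (G2 w)).
    (* Posteriors compare as likelihoods only if the observation has positive probability, because
       [condPr] is 0 otherwise. A positive likelihood of [w] ensures this; a zero one makes the
       claim trivial. *)
    have := ER_pair_mass_ge0 (G1 w) (G2 w).
    rewrite le_eqVlt => /orP[/eqP <-|L0]; first exact: ER_pair_mass_ge0.
    have := MAP (G1 w) (G2' w) (PiStar w).
    rewrite /posterior /condPr !Pr_observation -relabels.
    rewrite {1}/G2' relabelM mulgV relabel1 ler_pM2r; last first.
      rewrite invr_gt0 /Pr (bigD1 w)/= ?eqxx//.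
      apply: ltr_wpDr; first by apply: sumr_ge0 => ? _; exact: mass_ge0.
      by rewrite divr_gt0// ltr0n fact_gt0.
    by rewrite ler_pM2r// invr_gt0 ltr0n fact_gt0.
  (* The term of this [s] alone suffices: [x <= y] gives [x <= sqrt (x * y)]. *)
  rewrite (bigD1 s)//=; apply: ler_wpDr.
    by apply: sumr_ge0 => t _; rewrite divr_ge0.
  rewrite /mass ler_wpM2r ?invr_ge0// /B.
  rewrite -{1}(ger0_norm (ER_pair_mass_ge0 (G1 w) (G2 w))) -sqrtr_sqr.
  by rewrite ler_wsqrtr// expr2 ler_wpM2l ?ER_pair_mass_ge0.
rewrite exchange_big/=; apply: ler_sum => s _.
apply: le_trans _ (sum_bhattacharyya_le s).
rewrite pair_bigA/= -(pair_bigA _ (fun g _ => B g.1 g.2 s / n`!%:R))/=.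
rewrite le_eqVlt; apply/orP; left; apply/eqP; apply: eq_bigr => g _.
by rewrite sumr_const card_Sn -[LHS]mulr_natr divfK.
Qed.

End Achievability.

(** * Converse: the probabilities that one pair, or two pairs, of users are twins *)

Lemma natr_forall (R : comPzSemiRingType) (I : finType) (P : pred I) :
  [forall x, P x]%:R = \prod_x (P x)%:R :> R.
Proof.
case: (boolP [forall x, P x]) => [/forallP h|].
  by rewrite big1// => x _; rewrite h.
by move=> /forallPn[x Px]; rewrite (bigD1 x)//= (negbTE Px) mul0r.
Qed.

Lemma sum_ffun_pair (R : nmodType) (I T U : finType)
    (F : {ffun I -> T} -> {ffun I -> U} -> R) :
  \sum_g \sum_h F g h =
  \sum_(k : {ffun I -> T * U}) F [ffun e => (k e).1] [ffun e => (k e).2].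
Proof.
rewrite pair_bigA/= (reindex (fun k : {ffun I -> T * U} =>
  ([ffun e => (k e).1], [ffun e => (k e).2])))//=.
exists (fun gh : {ffun I -> T} * {ffun I -> U} =>
  [ffun e => (gh.1 e, gh.2 e)]).
  by move=> k _; apply/ffunP => e; rewrite !ffunE -surjective_pairing.
by move=> [g h] _; congr pair; apply/ffunP => e; rewrite !ffunE.
Qed.

Lemma cards2U2 (T : finType) (i j k l : T) : i != j -> k != l ->
  #|[set k; l] :|: [set i; j]|%SET =
  (2 + (k \notin [set i; j]%SET) + (l \notin [set i; j]%SET))%N.
Proof.
move=> ij kl; rewrite -finset.setUA !cardsU1 cards1 !inE.
rewrite (negbTE kl) ij/=.
by move: (k == i) (k == j) (l == i) (l == j); do 4!case.
Qed.

(** If the two pairs coincide, one transposition does; otherwise the product of the two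
    transpositions does, a 3-cycle when they share a user. Two twin events thus become invariance
    under one permutation. *)
Lemma double_swap n (i j k l : 'I_n) : i != j -> k != l ->
  exists2 s : 'S_n, ([set k; l] :|: [set i; j] \subset support s)%SET &
    forall (T : Type) (C : 'I_n -> T), C i = C j -> C k = C l ->
      forall x, C x = C (s x).
Proof.
move=> ij kl.
have sub (s : 'S_n) : [/\ s i != i, s j != j, s k != k & s l != l] ->
    ([set k; l] :|: [set i; j] \subset support s)%SET.
  case=> si sj sk sl; apply/fintype.subsetP => x; rewrite !inE.
  by move=> /orP[] /orP[] /eqP ->.
have tw T (C : 'I_n -> T) x y z : C x = C y -> C z = C (tperm x y z).
  by case: tpermP => // ->.
case: (boolP ((k \in [set i; j]) && (l \in [set i; j]))%SET) => klij.
  exists (tperm i j); last by move=> T C Cij _ x; exact: tw.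
  apply: sub; move: klij kl; rewrite !inE tpermL tpermR (eq_sym j) ij.
  by move=> /andP[] /orP[] /eqP -> /orP[] /eqP ->;
    rewrite ?eqxx// ?tpermL ?tpermR ?ij// eq_sym ij.
exists (tperm i j * tperm k l)%g; last first.
  by move=> T C Cij Ckl x; rewrite permM -tw// -tw.
apply: sub; rewrite !permM tpermL tpermR.
move: klij; rewrite !inE.
have tD x : x != i -> x != j -> tperm i j x = x.
  by move=> xi xj; rewrite tpermD// eq_sym.
have [ki|ki] := eqVneq k i; have [kj|kj] := eqVneq k j;
have [li|li] := eqVneq l i; have [lj|lj] := eqVneq l j => //= _.
all: try by move: ij kl; rewrite ?ki ?kj ?li ?lj ?eqxx.
all: try subst k; try subst l.
all: rewrite ?tpermL ?tpermR ?tD//.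
all: repeat match goal with H : is_true (_ != _) |- _ => move/eqP in H end.
all: by split; apply/eqP => //; case: tpermP => [e|e|e1 e2]; congruence.
Qed.

Section Twins.
Variables (R : realType) (n m : nat) (p q : edge_law R).
Hypotheses (p_prob : prob_vector p) (q_prob : prob_vector q).

Local Notation L := (@ER_pair_mass R n m p q).

Definition common (g1 g2 : graph n m) i a := g1 (inr (i, a)) && g2 (inr (i, a)).

Definition twins (g1 g2 : graph n m) i j :=
  [forall a, common g1 g2 i a == common g1 g2 j a].

(* Probability that two users agree on a given attribute in the graph of common
   edges. *)
Definition agree : R := q true true ^+ 2 + (1 - q true true) ^+ 2.

Let both (u : bool * bool) := u.1 && u.2.

Let sum_law (q' : edge_law R) : prob_vector q' ->
  \sum_(u : bool * bool) q' u.1 u.2 = 1.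
Proof.
by case=> _ <-; rewrite -(pair_bigA _ (fun a b => q' a b)).
Qed.

Let sum_both c : \sum_(u | both u == c) q u.1 u.2 =
  if c then q true true else 1 - q true true.
Proof.
have := edge_law_sum1 q_prob; rewrite big_mkcond.
rewrite -(pair_bigA _ (fun a b => if both (a, b) == c then q a b else 0))/=.
by rewrite !big_bool /both; case: c => /= E; lra.
Qed.

Lemma twins_prob i j : i != j ->
  \sum_g1 \sum_g2 L g1 g2 * (twins g1 g2 i j)%:R = agree ^+ m.
Proof.
move=> ij; pose V := @vpair_law R n m p q.
rewrite sum_ffun_pair.
(* [c] is the attribute row shared by [i] and [j]. Once it is fixed, the event splits into the
   constraints [w] on single vertex pairs. *)
pose w (c : {ffun 'I_m -> bool}) (e : vpair n m) (u : bool * bool) : R :=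
  if e is inr (x, a) then
    if x \in [set i; j]%SET then (both u == c a)%:R else 1 else 1.
transitivity (\sum_(k : {ffun vpair n m -> bool * bool}) \sum_c
  \prod_e (V e (k e).1 (k e).2 * w c e (k e))).
  apply: eq_bigr => k _.
  rewrite natr_forall (eq_bigr (fun a => \sum_c
      (both (k (inr (i, a))) == c)%:R * (both (k (inr (j, a))) == c)%:R));
    last first.
    move=> a _; rewrite /common !ffunE -/(both _) -/(both _) big_bool/=.
    by do 2!case: (both _); rewrite ?mulr1 ?mulr0 ?addr0 ?add0r.
  rewrite bigA_distr_bigA mulr_sumr/=; apply: eq_bigr => c _.
  rewrite [RHS]big_split/=; congr (_ * _).
    by apply: eq_bigr => e _; rewrite !ffunE.
  rewrite prod_vpair [X in _ = X * _]big1 ?mul1r//; apply: eq_bigr => a _.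
  rewrite (bigD1 i)//= (bigD1 j) 1?eq_sym//= !inE !eqxx orbT/= mulrA.
  rewrite [X in _ = _ * X]big1 ?mulr1// => x /andP[xi xj].
  by rewrite !inE (negbTE xi) (negbTE xj).
rewrite exchange_big/=.
rewrite (eq_bigr (fun c : {ffun 'I_m -> bool} => \prod_a
    (if c a then q true true else 1 - q true true) ^+ 2)); last first.
  move=> c _; rewrite -(bigA_distr_bigA (fun e u => V e u.1 u.2 * w c e u)).
  rewrite prod_vpair [X in X * _]big1 ?mul1r => [|u _]; last first.
    by rewrite -[RHS](sum_law p_prob); apply: eq_bigr => u' _; rewrite mulr1.
  apply: eq_bigr => a _; rewrite (bigD1 i)//= (bigD1 j) 1?eq_sym//= mulrA.
  rewrite !inE !eqxx orbT/= -expr2.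
  have -> : \sum_(u : bool * bool) q u.1 u.2 * (both u == c a)%:R =
      if c a then q true true else 1 - q true true.
    rewrite -sum_both [RHS]big_mkcond; apply: eq_bigr => u _.
    by case: eqP => _; rewrite ?mulr1 ?mulr0.
  rewrite [X in _ * X = _]big1 ?mulr1// => x /andP[xi xj].
  rewrite -[RHS](sum_law q_prob); apply: eq_bigr => u _.
  by rewrite !inE (negbTE xi) (negbTE xj) mulr1.
rewrite -(bigA_distr_bigA (fun _ c =>
  (if c : bool then q true true else 1 - q true true) ^+ 2)).
by rewrite prodr_const card_ord big_bool.
Qed.

(** Splitting each probability into two square roots, one of them taken at the moved vertex pair,
    gives a cyclic product. The matrix [Ma] has trace 1 and squared Frobenius norm [agree]. *)
Lemma invariant_prob_le (s : 'S_n) :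
  \sum_g1 \sum_g2 L g1 g2 *
    [forall x, common g1 g2 x.1 x.2 == common g1 g2 (s x.1) x.2]%:R <=
  (Num.sqrt agree ^+ m) ^+ #|support s|.
Proof.
pose V := @vpair_law R n m p q.
pose Mu (u v : bool * bool) : R := Num.sqrt (p u.1 u.2) * Num.sqrt (p v.1 v.2).
pose Ma (u v : bool * bool) : R :=
  Num.sqrt (q u.1 u.2) * Num.sqrt (q v.1 v.2) * (both u == both v)%:R.
have Mu_tr : \sum_u Mu u u = 1.
  rewrite -(sum_law p_prob); apply: eq_bigr => u _.
  by rewrite /Mu -expr2 sqr_sqrtr// p_prob.1.
have Ma_tr : \sum_u Ma u u = 1.
  rewrite -(sum_law q_prob); apply: eq_bigr => u _.
  by rewrite /Ma eqxx mulr1 -expr2 sqr_sqrtr// q_prob.1.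
have Mu_F : \sum_u \sum_v Mu u v ^+ 2 = 1.
  rewrite -[RHS]mulr1 -{1}(sum_law p_prob) -(sum_law p_prob) mulr_suml.
  apply: eq_bigr => u _; rewrite mulr_sumr; apply: eq_bigr => v _.
  by rewrite /Mu exprMn !sqr_sqrtr// p_prob.1.
have Ma_F : \sum_u \sum_v Ma u v ^+ 2 = agree.
  transitivity (\sum_(u : bool * bool) q u.1 u.2 *
      (if both u then q true true else 1 - q true true)).
    apply: eq_bigr => u _; rewrite -sum_both mulr_sumr [RHS]big_mkcond.
    apply: eq_bigr => v _; rewrite /Ma !exprMn !sqr_sqrtr ?q_prob.1// eq_sym.
    by case: eqP => _; rewrite ?expr1n ?mulr1// expr0n mulr0.
  have := edge_law_sum1 q_prob.
  rewrite -(pair_bigA _ (fun a b => q a b *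
      (if both (a, b) then q true true else 1 - q true true)))/=.
  rewrite !big_bool /both/= /agree => E.
  have -> : q false false = 1 - q true true - q true false - q false true.
    by lra.
  ring.
rewrite -Ma_F; apply: le_trans _ (@sum_prod_move_le n m R _ Mu Ma s _ _ Mu_tr
  Ma_tr _); last 3 first.
- by move=> u v; rewrite mulr_ge0// sqrtr_ge0.
- by move=> u v; rewrite !mulr_ge0// sqrtr_ge0.
- by rewrite Mu_F.
rewrite sum_ffun_pair le_eqVlt; apply/orP; left; apply/eqP.
apply: eq_bigr => k _.
pose S e := Num.sqrt (V e (k e).1 (k e).2).
have -> : L [ffun e => (k e).1] [ffun e => (k e).2] =
    \prod_e (S e * S (move_vpair s e)).
  have shift : \prod_e S (move_vpair s e) = \prod_e S e.
    by rewrite [RHS](reindex_inj (@move_vpair_inj n m s)).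
  rewrite big_split/= shift -big_split/=.
  apply: eq_bigr => e _; rewrite !ffunE -expr2 sqr_sqrtr//.
  exact: vpair_law_ge0.
rewrite natr_forall !prod_vpair -mulrA; congr (_ * _).
pose C := common [ffun e => (k e).1] [ffun e => (k e).2].
rewrite -(pair_bigA _ (fun x a => (C x a == C (s x) a)%:R)) exchange_big/=.
rewrite -big_split/=; apply: eq_bigr => a _; rewrite -big_split/=.
by apply: eq_bigr => x _; rewrite /C /common !ffunE.
Qed.

(** The exponent is the size of the union of the two pairs, which the permutation of [double_swap]
    moves entirely. *)
Lemma twins2_prob_le i j k l : i != j -> k != l -> agree <= 1 ->
  \sum_g1 \sum_g2 L g1 g2 * ((twins g1 g2 i j)%:R * (twins g1 g2 k l)%:R) <=
  (Num.sqrt agree ^+ m) ^+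
    (2 + (k \notin [set i; j]%SET) + (l \notin [set i; j]%SET))%N.
Proof.
move=> ij kl a1.
have rho01 : 0 <= Num.sqrt agree ^+ m <= 1.
  rewrite exprn_ge0 ?sqrtr_ge0//= exprn_ile1 ?sqrtr_ge0//.
  by rewrite -[leRHS]sqrtr1 ler_wsqrtr.
have [s sA sT] := double_swap ij kl.
rewrite -cards2U2//.
apply: le_trans (_ : _ <= (Num.sqrt agree ^+ m) ^+ #|support s|) _; last first.
  by rewrite ler_wiXn2l ?subset_leq_card//; case/andP: rho01.
apply: le_trans _ (invariant_prob_le s).
apply: ler_sum => g1 _; apply: ler_sum => g2 _.
rewrite ler_wpM2l ?ER_pair_mass_ge0// -natrM mulnb ler_nat.
case: andP => // -[tij tkl].
have -> // : [forall x, common g1 g2 x.1 x.2 == common g1 g2 (s x.1) x.2].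
apply/forallP => -[x a] /=; apply/eqP; apply: (sT _ (common g1 g2 ^~ a)).
  by move/forallP: tij => /(_ a)/eqP.
by move/forallP: tkl => /(_ a)/eqP.
Qed.

End Twins.

(** * Converse: existence of twins by the second moment method, and the resulting error *)

Section Converse.
Variables (R : realType) (n m : nat) (p q : edge_law R).
Hypotheses (p_prob : prob_vector p) (q_prob : prob_vector q).

Local Notation L := (@ER_pair_mass R n m p q).
Local Notation rho := (Num.sqrt (agree q) ^+ m).

Definition has_twins (g1 g2 : graph n m) :=
  [exists ij : 'I_n * 'I_n, (ij.1 != ij.2) && twins g1 g2 ij.1 ij.2].

Lemma agree_ge0 : 0 <= agree q.
Proof. by rewrite addr_ge0// sqr_ge0. Qed.

Lemma q11_ge0 : 0 <= q true true. Proof. exact: q_prob.1. Qed.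

Lemma q11_le1 : q true true <= 1.
Proof.
have := edge_law_sum1 q_prob; have := q_prob.1 true false.
have := q_prob.1 false true; have := q_prob.1 false false; lra.
Qed.

Lemma agree_le1 : agree q <= 1.
Proof. by have := q11_ge0; have := q11_le1; rewrite /agree; nra. Qed.

Lemma sqr_rho : rho ^+ 2 = agree q ^+ m.
Proof. by rewrite exprAC sqr_sqrtr ?agree_ge0. Qed.

Lemma rho_ge0 : 0 <= rho. Proof. by rewrite exprn_ge0 ?sqrtr_ge0. Qed.

Lemma rho_le1 : rho <= 1.
Proof.
by rewrite exprn_ile1 ?sqrtr_ge0// -[leRHS]sqrtr1 ler_wsqrtr ?agree_le1.
Qed.

Let Npairs (g1 g2 : graph n m) : R :=
  \sum_(ij : 'I_n * 'I_n | ij.1 != ij.2) (twins g1 g2 ij.1 ij.2)%:R.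

Let Epairs : \sum_g1 \sum_g2 L g1 g2 * Npairs g1 g2 =
  \sum_(ij : 'I_n * 'I_n | ij.1 != ij.2) rho ^+ 2.
Proof.
under eq_bigr do under eq_bigr do rewrite mulr_sumr.
under eq_bigr do rewrite exchange_big/=.
rewrite exchange_big/=; apply: eq_bigr => -[i j] ij.
by rewrite twins_prob// sqr_rho.
Qed.

Let Epairs_sqr_le : \sum_g1 \sum_g2 L g1 g2 * Npairs g1 g2 ^+ 2 <=
  \sum_(ij : 'I_n * 'I_n | ij.1 != ij.2) rho ^+ 2 * (2 + n%:R * rho) ^+ 2.
Proof.
have E g1 g2 : L g1 g2 * Npairs g1 g2 ^+ 2 =
    \sum_(ij : 'I_n * 'I_n | ij.1 != ij.2)
    \sum_(kl : 'I_n * 'I_n | kl.1 != kl.2) L g1 g2 *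
      ((twins g1 g2 ij.1 ij.2)%:R * (twins g1 g2 kl.1 kl.2)%:R).
  rewrite expr2 /Npairs mulr_suml mulr_sumr; apply: eq_bigr => ij _.
  by rewrite !mulr_sumr.
under eq_bigr do under eq_bigr do rewrite E.
under eq_bigr do rewrite exchange_big/=.
rewrite exchange_big/=; apply: ler_sum => -[i j]/= ij.
under eq_bigr do rewrite exchange_big/=.
rewrite exchange_big/=.
apply: (@le_trans _ _ (\sum_(kl : 'I_n * 'I_n | kl.1 != kl.2) rho ^+ 2 *
   (rho ^+ (kl.1 \notin [set i; j]%SET) *
    rho ^+ (kl.2 \notin [set i; j]%SET)))).
  apply: ler_sum => -[k l]/= kl.
  by rewrite mulrA -!exprD twins2_prob_le// agree_le1.
rewrite -mulr_sumr ler_wpM2l ?sqr_ge0//.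
(* Dropping the constraint that the two users differ makes the sum a square; its base is at most
   [2 + n * rho], the 2 coming from [i] and [j]. *)
apply: (@le_trans _ _ ((\sum_k rho ^+ (k \notin [set i; j]%SET)) ^+ 2)).
  rewrite expr2 mulr_suml.
  under [leRHS]eq_bigr do rewrite mulr_sumr.
  rewrite pair_bigA/= big_mkcond; apply: ler_sum => -[k l] _ /=.
  by case: ifP => // _; rewrite mulr_ge0// exprn_ge0 ?rho_ge0.
rewrite ler_sqr ?nnegrE; last 2 first.
- by apply: sumr_ge0 => k _; rewrite exprn_ge0 ?rho_ge0.
- by rewrite addr_ge0// mulr_ge0 ?rho_ge0.
rewrite (bigID (mem [set i; j]%SET))/= lerD//.
  rewrite (eq_bigr (fun=> 1)) => [|k]; last by move=> ->; rewrite expr0.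
  by rewrite sumr_const cards2 ij.
apply: (@le_trans _ _ (\sum_(k < n) rho)); last first.
  by rewrite sumr_const card_ord mulr_natl.
rewrite big_mkcond; apply: ler_sum => k _.
by case: (k \notin _); rewrite ?expr1// rho_ge0.
Qed.

Lemma has_twins_prob_ge : 2 <= n%:R * rho ->
  8^-1 <= \sum_g1 \sum_g2 L g1 g2 * (has_twins g1 g2)%:R.
Proof.
move=> u2; set P := (X in _ <= X); set u := n%:R * rho in u2 *.
have n2 : 2 <= n%:R :> R.
  by apply: le_trans u2 _; rewrite -[leRHS]mulr1 ler_wpM2l// rho_le1.
(* A linearized Cauchy-Schwarz: with twins, [(Npairs - 2 * c) ^ 2 >= 0]; without twins,
   [Npairs = 0]. *)
have lin (c : R) : 0 <= c ->
    4 * c * \sum_g1 \sum_g2 L g1 g2 * Npairs g1 g2 <=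
    4 * c ^+ 2 * P + \sum_g1 \sum_g2 L g1 g2 * Npairs g1 g2 ^+ 2.
  move=> c0; rewrite !mulr_sumr -big_split; apply: ler_sum => g1 _ /=.
  rewrite !mulr_sumr -big_split; apply: ler_sum => g2 _ /=.
  have := ER_pair_mass_ge0 p_prob q_prob g1 g2.
  have [|no] := boolP (has_twins g1 g2) => /= [_|].
    rewrite mulr1; have := sqr_ge0 (Npairs g1 g2 - 2 * c); nra.
  have -> : Npairs g1 g2 = 0.
    apply: big1 => ij ijn; move/existsPn: no => /(_ ij); rewrite ijn/=.
    by move/negbTE => ->.
  by rewrite !mulr0 expr0n/= !mulr0 addr0.
set mu := \sum_(ij : 'I_n * 'I_n | ij.1 != ij.2) rho ^+ 2.
have muE : u ^+ 2 / 2 <= mu.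
  rewrite /mu -(pair_big_dep xpredT (fun i j : 'I_n => i != j)
    (fun _ _ => rho ^+ 2))/=.
  rewrite (eq_bigr (fun=> n.-1%:R * rho ^+ 2)) => [|i _]; last first.
    rewrite (eq_bigl (predC1 i)) => [|j]; last by rewrite !inE eq_sym.
    by rewrite sumr_const cardC1 card_ord mulr_natl.
  rewrite sumr_const card_ord -[leRHS]mulr_natl.
  have -> : n.-1%:R = n%:R - 1 :> R.
    by rewrite -subn1 natrB// -(ler_nat R); lra.
  rewrite /u exprMn mulrA mulrAC; apply: ler_wpM2r; first exact: sqr_ge0.
  by rewrite -/u; nra.
have V := Epairs_sqr_le; rewrite -mulr_suml -/mu -/u in V.
(* [c] is half the bound on the ratio of second to first moment, the choice that gives the largest
   lower bound on [P]. *)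
have := lin ((2 + u) ^+ 2 / 2); rewrite Epairs -/mu.
move=> /(_ (divr_ge0 (sqr_ge0 _) (ler0n _ _))) h.
have {}h : mu <= (2 + u) ^+ 2 * P.
  have u0 : 0 < (2 + u) ^+ 2 by rewrite exprn_gt0//; lra.
  rewrite -(ler_pM2r u0); nra.
have uP : 0 <= P.
  apply: sumr_ge0 => g1 _; apply: sumr_ge0 => g2 _.
  by rewrite mulr_ge0// ER_pair_mass_ge0.
(* [P >= u ^ 2 / (2 * (2 + u) ^ 2)], and [2 + u <= 2 * u] makes this at least 1/8. *)
nra.
Qed.

(** The only product the swap can change is [q10 * q01], which becomes [q11 * q00]. The reverse
    exchange would need exactly one of the two users to have a common edge, which twins exclude. *)
Lemma swap_twins_le g1 g2 i j : p false false = 1 ->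
  ('I_m -> q true false * q false true <= q true true * q false false) ->
  i != j -> twins g1 g2 i j -> L g1 g2 <= L g1 (relabel (tperm i j) g2).
Proof.
move=> p00 corr ij tij.
have := ER_pair_mass_ge0 p_prob q_prob g1 g2; rewrite le_eqVlt.
move=> /orP[/eqP <-|L0]; first exact: ER_pair_mass_ge0.
have user u : g1 (inl u) = false /\ g2 (inl u) = false.
  clear corr.
  have : vpair_law p q (inl u : vpair n m) (g1 (inl u)) (g2 (inl u)) != 0.
    apply: contraTneq L0 => e0.
    by rewrite /ER_pair_mass (bigD1 (inl u))//= [p _ _]e0 mul0r ltxx.
  have /= := edge_law_sum1 p_prob; have := p_prob.1 true true.
  have := p_prob.1 true false; have := p_prob.1 false true.
  by rewrite p00; case: (g1 _); case: (g2 _) => // ? ? ? ? /eqP[]; lra.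
rewrite /ER_pair_mass !prod_vpair; apply: ler_pM.
- by apply: prodr_ge0 => u _; exact: p_prob.1.
- by apply: prodr_ge0 => a _; apply: prodr_ge0 => x _; exact: q_prob.1.
- rewrite le_eqVlt; apply/orP; left; apply/eqP; apply: eq_bigr => u _.
  by rewrite ffunE/= !(user _).2.
apply: ler_prod => a _; apply/andP; split.
  by apply: prodr_ge0 => x _; exact: q_prob.1.
rewrite (bigD1 i)//= (bigD1 j) 1?eq_sym//= mulrA.
rewrite [leRHS](bigD1 i)//= [X in _ <= _ * X](bigD1 j) 1?eq_sym//= mulrA.
rewrite !ffunE/= tpermV tpermL tpermR; apply: ler_pM.
- by rewrite mulr_ge0// q_prob.1.
- by apply: prodr_ge0 => x _; exact: q_prob.1.
- have corr_a := corr a; have := forallP tij a; rewrite /common => /eqP.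
  by do 4!case: (_ (inr _)) => //=; rewrite // mulrC// [leRHS]mulrC.
rewrite le_eqVlt; apply/orP; left; apply/eqP; apply: eq_bigr => x /andP[xi xj].
by rewrite ffunE/= tpermV tpermD// eq_sym.
Qed.

(** An outcome with twins on which the estimator is right is sent by the swap to one of no smaller
    mass, with the same observation but another [PiStar], hence to an error. *)
Lemma has_twins_error_le (pihat : estimator n m) : p false false = 1 ->
  ('I_n -> 'I_m ->
    q true false * q false true <= q true true * q false false) ->
  \sum_g1 \sum_g2 L g1 g2 * (has_twins g1 g2)%:R <=
  2 * error_prob p q pihat.
Proof.
move=> p00 corr.
rewrite -(sum_mass p q (fun g1 g2 => (has_twins g1 g2)%:R)).
have -> : \sum_w mass p q w * (has_twins (G1 w) (G2 w))%:R =
    \sum_(w : outcome n m | has_twins (G1 w) (G2 w)) mass p q w.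
  rewrite [RHS]big_mkcond; apply: eq_bigr => w _.
  by case: (has_twins _ _); rewrite ?mulr1 ?mulr0.
pose t (g1 g2 : graph n m) : 'S_n :=
  if [pick ij : 'I_n * 'I_n | (ij.1 != ij.2) && twins g1 g2 ij.1 ij.2]
  is Some ij then tperm ij.1 ij.2 else 1%g.
pose err w := pihat (G1 w) (G2' w) != PiStar w.
pose A := [set w : outcome n m | has_twins (G1 w) (G2 w) && ~~ err w]%SET.
(* Applying the swap of two twins to [G2] while undoing it in [PiStar] leaves
   the observation unchanged. *)
pose phi (w : outcome n m) : outcome n m :=
  let s := t (G1 w) (G2 w) in (G1 w, relabel s (G2 w), (s^-1 * PiStar w)%g).
have phi_obs w : G2' (phi w) = G2' w.
  by rewrite /G2' [in LHS]/G2/= relabelM mulgA mulgV mul1g.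
have phi_inj : {in A &, injective phi}.
  (* On [A] the estimator is right, so the observation determines [PiStar] and then [G2]. *)
  move=> w1 w2; rewrite !inE => /andP[_ e1] /andP[_ e2] e.
  have e1' : G1 w1 = G1 w2 by case: e.
  have e2' : G2' w1 = G2' w2 by rewrite -phi_obs e phi_obs.
  have e3 : PiStar w1 = PiStar w2.
    by move: e1 e2; rewrite /err !negbK => /eqP <- /eqP <-; rewrite e1' e2'.
  have : G2 w1 = G2 w2.
    have := congr1 (relabel (PiStar w1)^-1%g) e2'.
    by rewrite /G2' e3 !relabelM !mulgV !relabel1.
  move: e1' e3; case: w1 {e1 e e2'} => [[? ?] ?]; case: w2 {e2} => [[? ?] ?].
  by rewrite /G1 /G2 /PiStar/= => -> -> ->.
have tP w : has_twins (G1 w) (G2 w) ->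
    t (G1 w) (G2 w) != 1%g /\ mass p q w <= mass p q (phi w).
  rewrite /phi /t => /existsP[ij0 ij0P].
  case: pickP => [ij|/(_ ij0)]; last first.
    by rewrite ij0P.
  move=> /andP[ijn ijt]; split.
    apply: contraNneq ijn => /permP/(_ ij.1); rewrite tpermL perm1 => ->.
    exact: eqxx.
  rewrite ler_wpM2r ?invr_ge0//.
  exact: swap_twins_le (corr ij.1) ijn ijt.
(* Twin outcomes with and without an error each weigh at most the error probability, whence the
   factor 2. *)
rewrite (bigID err)/= mulr_natl mulr2n lerD//.
  rewrite /error_prob /Pr [leRHS](bigID (fun w => has_twins (G1 w) (G2 w)))/=.
  rewrite (eq_bigl (fun w => err w && has_twins (G1 w) (G2 w))) => [|w].
    by rewrite lerDl sumr_ge0// => w _; exact: mass_ge0.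
  exact: andbC.
rewrite (eq_bigl (mem A)) => [|w]; last by rewrite !inE.
apply: (@le_trans _ _ (\sum_(w in A) mass p q (phi w))).
  by apply: ler_sum => w; rewrite !inE => /andP[wt _]; exact: (tP w wt).2.
rewrite -(big_imset _ phi_inj)/= /error_prob /Pr.
rewrite [leRHS]big_mkcond [leLHS]big_mkcond; apply: ler_sum => w _.
case: ifP => [/imsetP[w' w'A ->]|_]; last by case: ifP => // _; exact: mass_ge0.
rewrite phi_obs; move: w'A; rewrite !inE => /andP[wt]; rewrite /err negbK.
move=> /eqP -> /=; rewrite ifT//.
have [t1 _] := tP _ wt.
apply: contraNneq t1 => e.
by rewrite -invg_eq1 -(inj_eq (mulIg (PiStar w'))) mul1g -e.
Qed.

End Converse.

(** * Positive correlation expressed through the edge law *)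

Section EdgeCorrelation.
Variables (R : realType) (n m : nat) (p q : edge_law R).
Hypotheses (p_prob : prob_vector p) (q_prob : prob_vector q).

Lemma Ex_edge (e : vpair n m) (F : bool -> bool -> R) :
  Ex (mass p q) (fun w => F (G1 w e) (G2 w e)) =
  \sum_a \sum_b vpair_law p q e a b * F a b.
Proof.
rewrite /Ex (sum_mass p q (fun g1 g2 => F (g1 e) (g2 e))) sum_ffun_pair.
pose V := @vpair_law R n m p q.
have V1 e' : \sum_(u : bool * bool) V e' u.1 u.2 = 1.
  rewrite -(pair_bigA _ (fun a b => V e' a b)).
  by case: e' => [u|x]; [case: p_prob|case: q_prob].
transitivity (\prod_e' \sum_(u : bool * bool)
    V e' u.1 u.2 * (if e' == e then F u.1 u.2 else 1)).
  rewrite bigA_distr_bigA; apply: eq_bigr => k _.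
  rewrite big_split/=; congr (_ * _).
    by apply: eq_bigr => e' _; rewrite !ffunE.
  rewrite (bigD1 e)//= eqxx big1 ?mulr1 ?ffunE// => e' /negbTE e'e.
  by rewrite e'e.
rewrite (bigD1 e)//= [X in _ * X]big1 ?mulr1 => [|e' e'e]; last first.
  rewrite -[RHS](V1 e'); apply: eq_bigr => u _.
  by rewrite (negbTE e'e) mulr1.
by rewrite eqxx -(pair_bigA _ (fun a b => V e a b * F a b)).
Qed.

(** The covariance of the two indicators is [q11 * q00 - q10 * q01]. The arguments in ['I_n] and
    ['I_m] supply an attribute pair, without which the correlation hypothesis is vacuous. *)
Lemma positive_correlation_law :
  attribute_edges_positively_correlated n m p q -> 'I_n -> 'I_m ->
  q true false * q false true <= q true true * q false false.
Proof.
move=> corr i a; have [vX vY] := corr i a.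
rewrite /Defs.corr pmulr_lgt0 ?invr_gt0 ?mulr_gt0 ?sqrtr_gt0//.
rewrite /cov; set X := Ex _ (edge_indicator _ (@G1 n m) _).
set Y := Ex _ (edge_indicator _ (@G2 n m) _).
rewrite (Ex_edge (inr (i, a)) (fun a b => (a%:R - X) * (b%:R - Y))).
have -> : X = q true true + q true false.
  rewrite /X (Ex_edge (inr (i, a)) (fun a _ => a%:R)) !big_bool/=; ring.
have -> : Y = q true true + q false true.
  rewrite /Y (Ex_edge (inr (i, a)) (fun _ b => b%:R)) !big_bool/=; ring.
have := edge_law_sum1 q_prob; rewrite !big_bool/= => E.
have -> : q false false = 1 - q true true - q true false - q false true.
  by lra.
by nra.
Qed.

End EdgeCorrelation.

(** * Exponential estimates and passage to the limit *)

Lemma expR_ge_quadratic (R : realType) (x : R) :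
  0 <= x -> 1 + x + x ^+ 2 / 2 <= expR x.
Proof.
move=> x0.
have -> : 1 + x + x ^+ 2 / 2 = series (exp_coeff x) 3.
  by rewrite /series/= !big_nat_recr//= big_nil /exp_coeff/= expr0 expr1
    add0r !divr1.
apply: nondecreasing_cvgn_le; last exact: is_cvg_series_exp_coeff.
apply/nondecreasing_seqP => n; rewrite /series/= big_nat_recr//= lerDl.
exact: exp_coeff_ge0.
Qed.

Lemma agree_ge_expR (R : realType) (q : edge_law R) :
  0 <= q true true -> expR (- (2 * q true true)) <= agree q.
Proof.
rewrite /agree; set x := q true true => x0.
have x20 : 0 <= 2 * x by rewrite mulr_ge0.
have h := expR_ge_quadratic x20.
rewrite expRN -[leLHS]mul1r ler_pdivrMr ?expR_gt0//.
(* [(1 - 2 x + 2 x^2) (1 + 2 x + 2 x^2) = 1 + 4 x^4]; the linear bound on [expR] would fall short of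
   1 for small [x > 0]. *)
apply: le_trans (ler_wpM2l _ h); first by have := sqr_ge0 (x ^+ 2); nra.
by rewrite addr_ge0// sqr_ge0.
Qed.

Local Open Scope classical_set_scope.
Local Open Scope ring_scope.

Lemma limn_einf_gt0 (R : realType) (u : nat -> R) (c : R) : 0 < c ->
  (\forall n \near \oo, c <= u n) -> (0 < limn_einf (fun n => (u n)%:E))%E.
Proof.
move=> c0 [N _ uN]; apply: (@lt_le_trans _ _ c%:E); first by rewrite lte_fin.
rewrite limn_einf_lim; apply: lime_ge; first exact: is_cvg_einfs.
exists N => // n /= Nn; apply/ereal_infP => _ [k /= nk <-].
by rewrite lee_fin; apply: uN => /=; exact: leq_trans nk.
Qed.

Lemma expR_lnB (R : realType) n (x : R) : (0 < n)%N ->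
  expR (ln n%:R - x) = n%:R * expR (- x).
Proof. by move=> n0; rewrite expRD lnK// posrE ltr0n. Qed.

Lemma sqrt_le_expR (R : realType) (q : edge_law R) (k : nat) :
  Num.sqrt (1 - 2 * psi q) ^+ k <= expR (- (k%:R * psi q)).
Proof.
rewrite -[X in expR X]mulrN expRM_natl lerXn2r ?nnegrE ?sqrtr_ge0 ?expR_ge0//.
rewrite -[leRHS]ger0_norm ?expR_ge0// -sqrtr_sqr ler_wsqrtr//.
by rewrite -expRM_natl mulrN -mulNr; apply: le_trans (expR_ge1Dx _); lra.
Qed.

Lemma expR_le_sqrt_agree (R : realType) (q : edge_law R) (k : nat) :
  0 <= q true true ->
  expR (- (k%:R * q true true)) <= Num.sqrt (agree q) ^+ k.
Proof.
move=> q0; rewrite -[X in expR X]mulrN expRM_natl lerXn2r ?nnegrE ?sqrtr_ge0 ?expR_ge0//.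
rewrite -[leLHS]ger0_norm ?expR_ge0// -sqrtr_sqr ler_wsqrtr//.
by rewrite -expRM_natl mulrN agree_ge_expR.
Qed.

Theorem theorem9 (R : realType) (m : nat -> nat) (p q : nat -> edge_law R)
    (p_prob : forall n, prob_vector (p n))
    (q_prob : forall n, prob_vector (q n))
    (p00_eq1 : forall n, p n false false = 1)
    (pos_corr : forall n,
       attribute_edges_positively_correlated n (m n) (p n) (q n)) :
  (((m n)%:R * psi (q n) - ln n%:R) @[n --> \oo] --> +oo ->
     forall pihat : forall n, estimator n (m n),
       (forall n, is_MAP (p n) (q n) (pihat n)) ->
       error_prob (p n) (q n) (pihat n) @[n --> \oo] --> (0 : R))
  /\
  ((ln n%:R - (m n)%:R * q n true true) @[n --> \oo] --> +oo ->
     forall pihat : forall n, estimator n (m n),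
       (0 < limn_einf (fun n => (error_prob (p n) (q n) (pihat n))%:E))%E).
Proof.
split=> [/cvgryPge h pihat MAP|/cvgryPge h pihat].
  apply/cvgr0Pnorm_le => eps eps0.
  (* 1/2 bounds the ratio of the geometric series, and [eps / 2] absorbs the factor 2 of its sum. *)
  pose d := Num.min 2^-1 (eps / 2).
  have d0 : 0 < d by rewrite lt_min invr_gt0 ltr0n divr_gt0.
  have := h (- ln d); apply: filterS2 (nbhs_infty_gt 0) => n n0 hn.
  have small : n%:R * Num.sqrt (1 - 2 * psi (q n)) ^+ m n <= d.
    apply: le_trans (_ : n%:R * expR (- ((m n)%:R * psi (q n))) <= _).
      by rewrite ler_wpM2l// sqrt_le_expR.
    by rewrite -expR_lnB// -[leRHS]lnK ?posrE// ler_expR; lra.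
  rewrite ger0_norm; last first.
    by apply: sumr_ge0 => w _; apply: mass_ge0.
  apply: le_trans (MAP_error_le (p_prob n) (q_prob n) (MAP n)) _.
  apply: le_trans (sum_expr_support_le _ _) _.
  - by rewrite exprn_ge0// sqrtr_ge0.
  - by apply: le_trans small _; rewrite ge_min lexx.
  by move: small; rewrite /d le_min => /andP[_]; lra.
(* The twin probability 1/8, halved. *)
apply: (@limn_einf_gt0 _ _ 16^-1); first by rewrite invr_gt0.
(* The threshold [ln 2] gives [n * expR (- m q11) >= 2], as the second moment bound requires. *)
have := h (ln 2); apply: filterS2 (nbhs_infty_gt 0) => n n0 hn.
have q0 := (q_prob n).1 true true.
have big : 2 <= n%:R * Num.sqrt (agree (q n)) ^+ m n.
  apply: le_trans (ler_wpM2l _ (expR_le_sqrt_agree (m n) q0)) => //.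
  by rewrite -expR_lnB// -[leLHS]lnK ?posrE// ler_expR.
have := has_twins_prob_ge (p_prob n) (q_prob n) big.
have := has_twins_error_le (p_prob n) (q_prob n) (pihat n) (p00_eq1 n)
  (positive_correlation_law (p_prob n) (q_prob n) (@pos_corr n)).
lra.
Qed.
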